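(* Let $n\geq 2$ and let $G$ be the $(2n+1)$-dimensional Heisenberg group, $G=\langle x_1,\dots,x_{2n+1}\mid [x_i,x_{n+i}]=x_{2n+1}\ (1\le i\le n),\ \text{all other pairs } x_j,x_k \text{ commute}\rangle$, with Mal'cev basis $(x_1,\dots,x_{2n+1})$. Then for every ordering of the basis of $\mathfrak{R}G/I^3$ for which the Jennings representation of $G$ is upper unitriangular, the image of $G$ in $UT_d(\mathbb{Z})$ ($d=\dim \mathfrak{R}G/I^3$) is a distorted subgroup.
   Context: $UT_d(\mathbb{Z})$ is the group of upper unitriangular $d\times d$ integer matrices. Jennings representation: $G$ has nilpotency class $2$; $\mathfrak{R}$ is a field of characteristic $0$, $I$ is the augmentation ideal of the group algebra $\mathfrak{R}G$. With $u_i=1-x_i$, $\mu(u_i)=1$ for $i\le 2n$ and $\mu(u_{2n+1})=2$, the cosets of the products $u_1^{r_1}\cdots u_{2n+1}^{r_{2n+1}}$ with $\sum r_i\mu(u_i)\le 2$ form a basis of $\mathfrak{R}G/I^3$; $G$ acts faithfully on $\mathfrak{R}G/I^3$ by right multiplication, by integer matrices w.r.t. this basis, and an ordering of the basis making all these matrices upper unitriangular gives an embedding $G\to UT_d(\mathbb{Z})$. A subgroup $H$ of a finitely generated group $K$ is distorted if its distortion function $\Delta_H^K(n)=\max\{dist_H(1,h): h\in H, dist_K(1,h)\le n\}$ (word metrics) is not bounded by $Cn$ for a constant $C$ (equivalently, not $\sim n$). *)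

(* Defs.v *)
From HB Require Import structures.
From mathcomp Require Import all_boot all_order all_algebra.
Set Implicit Arguments. Unset Strict Implicit. Unset Printing Implicit Defensive.
Import Order.TTheory GRing.Theory Num.Theory.
Local Open Scope ring_scope.

(* Element ((a, b), c) with a b in Z^n, c in Z; it stands for the normal form
   x_1^{a_1} ... x_n^{a_n} x_{n+1}^{b_1} ... x_{2n}^{b_n} x_{2n+1}^{c}.      *)
Definition heis (n : nat) := ('rV[int]_n * 'rV[int]_n * int)%type.

Definition heis_one (n : nat) : heis n := ((0, 0), 0).

Definition heis_mul (n : nat) (g h : heis n) : heis n :=
  let: ((a, b), c) := g in let: ((a', b'), c') := h in
  ((a + a', b + b'), c + c' + (a *m b'^T) 0 0).

Definition heis_inv (n : nat) (g : heis n) : heis n :=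
  let: ((a, b), c) := g in ((- a, - b), - c + (a *m b^T) 0 0).

Definition unitrow (n i : nat) : 'rV[int]_n := \row_(j < n) ((j == i :> nat)%:R).

(* the Mal'cev generators x_1, ..., x_{2n+1} (0-indexed: k = 0 .. 2n);
   with [a,b] = a^-1 b^-1 a b one has [x_i, x_{n+i}] = x_{2n+1}            *)
Definition heis_gen (n k : nat) : heis n :=
  if (k < n)%N then ((unitrow n k, 0), 0)
  else if (k < n.*2)%N then ((0, unitrow n (k - n)), 0)
  else ((0, 0), 1).

Section GroupAlgebra.
Variables (R : comNzRingType) (n : nat).

Definition ga := seq (R * heis n).
Definition ga_coef (s : ga) (x : heis n) : R :=
  \sum_(p <- s) (if p.2 == x then p.1 else 0).
Definition ga_of (g : heis n) : ga := [:: (1, g)].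
Definition ga_one : ga := ga_of (heis_one n).
Definition ga_scale (c : R) (s : ga) : ga := [seq (c * p.1, p.2) | p <- s].
Definition ga_add (s t : ga) : ga := s ++ t.
Definition ga_sub (s t : ga) : ga := s ++ ga_scale (-1) t.
Definition ga_mul (s t : ga) : ga :=
  [seq (p.1 * q.1, heis_mul p.2 q.2) | p <- s, q <- t].
Definition ga_pow (s : ga) (k : nat) : ga := iter k (ga_mul s) ga_one.

Definition ga_u (g : heis n) : ga := [:: (1, heis_one n); (-1, g)].

Definition in_I3 (s : ga) : Prop :=
  exists L : seq (R * heis n * heis n * heis n),
    ga_coef s =1 ga_coef (flatten
      [seq ga_scale l.1.1.1 (ga_mul (ga_u l.1.1.2) (ga_mul (ga_u l.1.2) (ga_u l.2)))
      | l <- L]).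
End GroupAlgebra.

Definition jmu (n : nat) (i : 'I_(n.*2.+1)) : nat := if (i < n.*2)%N then 1 else 2.
Definition jweight (n : nat) (r : {ffun 'I_(n.*2.+1) -> 'I_3}) : nat :=
  \sum_i (r i * jmu i)%N.
Definition jidx (n : nat) := {r : {ffun 'I_(n.*2.+1) -> 'I_3} | (jweight r <= 2)%N}.

Definition jbasis (R : comNzRingType) (n : nat) (r : jidx n) : ga R n :=
  foldr (@ga_mul R n) (ga_one R n)
    [seq ga_pow (ga_u R (heis_gen n i)) (val r i) | i : 'I_(n.*2.+1) <- enum 'I_(n.*2.+1)].

(* rho g is the matrix (row convention) of right multiplication by g on R G / I^3
   w.r.t. the ordered basis (jbasis (sigma 0), ..., jbasis (sigma (d-1))):
     jbasis(sigma i) * g  ==  sum_j (rho g i j) jbasis(sigma j)   mod I^3     *)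
Definition jennings_matrix (R : comNzRingType) (n d : nat) (sigma : 'I_d -> jidx n)
  (g : heis n) (M : 'M[int]_d) : Prop :=
  forall i : 'I_d,
    in_I3 (ga_sub (ga_mul (jbasis R (sigma i)) (ga_of R g))
                  (flatten [seq ga_scale ((M i j)%:~R) (jbasis R (sigma j))
                           | j <- enum 'I_d])).

Definition upper_unitri (d : nat) (M : 'M[int]_d) : Prop :=
  forall i j : 'I_d, ((j < i)%N -> M i j = 0) /\ ((i == j) -> M i j = 1).

Definition UT_gens (d : nat) : seq 'M[int]_d :=
  flatten [seq [:: 1%:M + delta_mx p.1 p.2; 1%:M - delta_mx p.1 p.2]
          | p : 'I_d * 'I_d <- enum [pred p : 'I_d * 'I_d | (p.1 < p.2)%N]].

Definition word_ball (d : nat) (S : seq 'M[int]_d) (m : nat) (M : 'M[int]_d) : Prop :=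
  exists w : seq 'M[int]_d, [/\ all (mem S) w, (size w <= m)%N & foldr mulmx 1%:M w = M].

(* H = <SH> is distorted in K = <SK> (SH, SK finite symmetric generating sets):
   there is no C with dist_H(1,h) <= C * dist_K(1,h) for all h in H,
   i.e. the distortion function Delta_H^K(m) is not bounded by C m. *)
Definition distorted (d : nat) (SK SH : seq 'M[int]_d) : Prop :=
  ~ exists C : nat, forall (m : nat) (h : 'M[int]_d),
      (exists k, word_ball SH k h) -> word_ball SK m h -> word_ball SH (C * m) h.

Definition heis_image_gens (n d : nat) (rho : heis n -> 'M[int]_d) : seq 'M[int]_d :=
  flatten [seq [:: rho (heis_gen n k); rho (heis_inv (heis_gen n k))] | k <- iota 0 n.*2.+1].

(* Main.v *)
Require Import Defs.
From HB Require Import structures.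
From mathcomp Require Import all_boot all_order all_algebra.
From mathcomp Require Import zify ring.
Import Order.TTheory GRing.Theory Num.Theory.
Local Open Scope ring_scope.
Set Implicit Arguments. Unset Strict Implicit. Unset Printing Implicit Defensive.

(* The function sending the group element with Mal'cev exponents t_i to
   prod_i (-1)^(q_i) binom(t_i, q_i) has weighted degree sum_i q_i mu_i; when this is at most 2
   it vanishes on I^3, and these functions form the basis dual to the Jennings basis.
   Evaluating them on translates computes every entry of rho g.  In particular rho is a
   homomorphism and rho (x_{2n+1}^m) = 1 - m E_{1, u_{2n+1}}.  Triangularity forces 1 to come
   before every u_{n+i} and every u_{n+i} (i <= n) before u_{2n+1}, so as n >= 2 this entry is
   at distance at least 3 from the diagonal.  Hence x_{2n+1}^(k^3) has length O(k) in UT_d(Z),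
   whereas a word of length L in G has central exponent at most L(L+1). *)

Local Arguments heis_mul : simpl never.

(** * Normal-form exponents in the Heisenberg group *)

Section HeisenbergGroup.
Variable n : nat.
Implicit Types (a b : 'rV[int]_n) (g h x : heis n).

Definition dot a b : int := (a *m b^T) 0 0.

Lemma dotDl a a' b : dot (a + a') b = dot a b + dot a' b.
Proof. by rewrite /dot mulmxDl mxE. Qed.

Lemma dotC a b : dot a b = dot b a.
Proof. by rewrite /dot !mxE; apply: eq_bigr => i _; rewrite !mxE mulrC. Qed.

Lemma dotDr a b b' : dot a (b + b') = dot a b + dot a b'.
Proof. by rewrite dotC dotDl !(dotC a). Qed.

Lemma dotNl a b : dot (- a) b = - dot a b.
Proof. by rewrite /dot mulNmx mxE. Qed.

Lemma dot0l b : dot 0 b = 0.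
Proof. by rewrite /dot mul0mx mxE. Qed.

Lemma dot0r a : dot a 0 = 0.
Proof. by rewrite dotC dot0l. Qed.

Lemma dot_unitrow i j : (i < n)%N -> dot (unitrow n i) (unitrow n j) = (j == i)%:R.
Proof.
move=> lt_in; rewrite /dot mxE (bigD1 (Ordinal lt_in)) //= !mxE eqxx mul1r.
rewrite big1 ?addr0 ?[i == j]eq_sym // => k; rewrite -val_eqE /= !mxE => /negbTE ->.
by rewrite mul0r.
Qed.

Lemma heis_mulE a b c a' b' c' :
  heis_mul ((a, b), c) ((a', b'), c') = ((a + a', b + b'), c + c' + dot a b').
Proof. by []. Qed.

Lemma heis_mulA g h x : heis_mul g (heis_mul h x) = heis_mul (heis_mul g h) x.
Proof.
case: g h x => [[a b] c] [[a' b'] c'] [[a2 b2] c2].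
by rewrite !heis_mulE !addrA dotDl dotDr; congr (_, _); ring.
Qed.

Lemma heis_mul1g g : heis_mul (heis_one n) g = g.
Proof. by case: g => [[a b] c]; rewrite heis_mulE dot0l !add0r addr0. Qed.

Lemma heis_mulg1 g : heis_mul g (heis_one n) = g.
Proof. by case: g => [[a b] c]; rewrite heis_mulE dot0r !addr0. Qed.

(* The exponents in x_1^{r_0} ... x_{2n+1}^{r_{2n}}: since x^a y^b is
   ((a, b), a . b), the central exponent is c - a . b and not c. *)
Definition hcoord (j : nat) g : int :=
  let: ((a, b), c) := g in
  if (j < n)%N then dot a (unitrow n j)
  else if (j < n.*2)%N then dot b (unitrow n (j - n)) else c - dot a b.

Lemma hcoord_one j : hcoord j (heis_one n) = 0.
Proof. by rewrite /hcoord /heis_one !dot0l subr0; case: ifP => // _; case: ifP. Qed.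

Lemma hcoord_addn k g : (k < n)%N -> hcoord (n + k) g = dot g.1.2 (unitrow n k).
Proof.
case: g => [[a b] c] lt_kn /=.
by rewrite ltnNge leq_addr -addnn ltn_add2l lt_kn addKn.
Qed.

(** Collecting moves each [x_{n+i}] of [g] past the [x_i] of [h], and every such swap costs an
    inverse [x_{2n+1}]; this is the term [dot g.1.2 h.1.1]. *)
Lemma hcoordM j g h :
  hcoord j (heis_mul g h) =
    hcoord j g + hcoord j h - (if (j < n.*2)%N then 0 else dot g.1.2 h.1.1).
Proof.
case: g h => [[a b] c] [[a' b'] c']; rewrite heis_mulE /= !dotDl.
case: ifP => [lt_jn|_]; first by rewrite ifT ?subr0 //; lia.
by case: ifP => _; rewrite ?subr0 // !dotDr (dotC b a'); ring.
Qed.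

Lemma hcoord_gen j k : (j < n.*2.+1)%N -> (k < n.*2.+1)%N ->
  hcoord j (heis_gen n k) = (j == k)%:R.
Proof.
move=> lt_j lt_k; rewrite /heis_gen.
case: (ltnP k n) => [lt_kn|le_nk] /=.
  rewrite dot_unitrow // !dot0l dot0r subr0.
  case: ifP => // ?; rewrite (_ : (j == k) = false); last by lia.
  by rewrite if_same.
case: (ltnP k n.*2) => [lt_k2|le_2k] /=; rewrite ?dot0l ?dot0r.
  rewrite dot_unitrow; last by lia.
  case: ifP => [?|?]; first by rewrite (_ : (j == k) = false) //; lia.
  by case: ifP => [?|?]; rewrite ?subr0; [congr (_ %:R) |]; lia.
case: ifP => ?; first by rewrite (_ : (j == k) = false) //; lia.
case: ifP => ?; first by rewrite (_ : (j == k) = false) //; lia.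
by rewrite subr0 (_ : (j == k) = true) //; lia.
Qed.

(** The normal form of [x] has no generator of index below [k], so prefixing the generator of index
    [k] gives a normal form again, with no collection. *)
Lemma hcoord_genM j k x : (j < n.*2.+1)%N -> (k < n.*2.+1)%N ->
  (forall i, (i < k)%N -> hcoord i x = 0) ->
  hcoord j (heis_mul (heis_gen n k) x) = hcoord j x + (j == k)%:R.
Proof.
move=> lt_j lt_k x0; rewrite hcoordM hcoord_gen //.
suff -> : dot (heis_gen n k).1.2 x.1.1 = 0 by rewrite if_same subr0 addrC.
rewrite /heis_gen; case: (ltnP k n) => [?|le_nk] /=; first by rewrite dot0l.
case: (ltnP k n.*2) => [?|?] /=; last by rewrite dot0l.
have lt_kn : (k - n < n)%N by lia.
have := x0 (k - n)%N; case: x {x0} => [[a b] c] /=; rewrite lt_kn dotC.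
by apply; lia.
Qed.

End HeisenbergGroup.

(** * Polynomial functions and their evaluation on the group algebra *)

Section PolynomialFunctions.
Variables (R : comNzRingType) (n : nat).
Implicit Types (f : heis n -> R) (g h x : heis n) (s t : ga R n).

(** Polynomial functions of degree at most [k], in the sense that every [(k+1)]-fold right
    difference vanishes. Extended linearly, they kill the [(k+1)]-st power of the augmentation
    ideal. *)
Fixpoint polydeg (k : nat) f : Prop :=
  if k is k'.+1 then forall g, polydeg k' (fun x => f (heis_mul x g) - f x)
  else forall g x, f (heis_mul x g) = f x.

Lemma eq_polydeg k f1 f2 : f1 =1 f2 -> polydeg k f1 -> polydeg k f2.
Proof.
elim: k f1 f2 => [|k IHk] f1 f2 eqf pf1 g => [x|]; first by rewrite -!eqf pf1.
by apply: IHk (pf1 g) => x; rewrite !eqf.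
Qed.

Lemma polydeg_cst k (c : R) : polydeg k (fun=> c).
Proof.
by elim: k c => //= k IHk c g; apply: eq_polydeg (IHk 0) => x; rewrite subrr.
Qed.

Lemma polydegD k f1 f2 :
  polydeg k f1 -> polydeg k f2 -> polydeg k (fun x => f1 x + f2 x).
Proof.
elim: k f1 f2 => [|k IHk] f1 f2 pf1 pf2 g => [x|]; first by rewrite pf1 pf2.
by apply: eq_polydeg (IHk _ _ (pf1 g) (pf2 g)) => x; ring.
Qed.

Lemma polydegZ k (c : R) f : polydeg k f -> polydeg k (fun x => c * f x).
Proof.
elim: k f => [|k IHk] f pf g => [x|]; first by rewrite pf.
by apply: eq_polydeg (IHk _ (pf g)) => x; ring.
Qed.

Lemma polydegS k f : polydeg k f -> polydeg k.+1 f.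
Proof.
elim: k f => [|k IHk] f pf g; last exact: IHk.
by apply: (@eq_polydeg 0 (fun=> 0)) => // x; rewrite pf subrr.
Qed.

Lemma polydegW k l f : (k <= l)%N -> polydeg k f -> polydeg l f.
Proof.
by move=> /subnK <-; elim: (l - k)%N => // m IHm /IHm; apply: polydegS.
Qed.

Lemma polydeg_shift k g f : polydeg k f -> polydeg k (fun x => f (heis_mul x g)).
Proof.
case: k f => [|k] f pf h => [x|]; first by rewrite !pf.
(* The difference by [h] of the translate is the difference of [f] by [h g] minus its difference by
   [g]. *)
apply: (@eq_polydeg _ (fun x => (f (heis_mul x (heis_mul h g)) - f x)
                               + -1 * (f (heis_mul x g) - f x))).
  by move=> x; rewrite -heis_mulA; ring.
by apply: polydegD (pf _) (polydegZ _ (pf _)).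
Qed.

Lemma polydegM k l f1 f2 :
  polydeg k f1 -> polydeg l f2 -> polydeg (k + l) (fun x => f1 x * f2 x).
Proof.
have [m] := ubnP (k + l); elim: m k l f1 f2 => // m IHm [|k] [|l] f1 f2 lt_m pf1 pf2 g.
- by move=> x; rewrite pf1 pf2.
- apply: eq_polydeg (IHm 0%N l _ _ _ pf1 (pf2 g)) => [x|]; last by lia.
  by rewrite pf1; ring.
- apply: eq_polydeg (IHm k 0%N _ _ _ (pf1 g) pf2) => [x|]; last by lia.
  by rewrite pf2; ring.
(* Leibniz rule for differences: one factor appears translated, hence the use of [polydeg_shift]. *)
apply: (@eq_polydeg _ (fun x => (f1 (heis_mul x g) - f1 x) * f2 (heis_mul x g)
                              + f1 x * (f2 (heis_mul x g) - f2 x))).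
  by move=> x; ring.
apply: polydegD.
  by apply: IHm (pf1 g) (polydeg_shift g pf2); lia.
by have := IHm k.+1 l _ _ _ pf1 (pf2 g); rewrite addSnnS; apply; lia.
Qed.

Lemma polydeg_prod (I : Type) (s : seq I) (F : I -> heis n -> R) (m : I -> nat) :
  (forall i, polydeg (m i) (F i)) ->
  polydeg (\sum_(i <- s) m i) (fun x => \prod_(i <- s) F i x).
Proof.
move=> pF; elim: s => [|i s IHs].
  by rewrite big_nil; apply: (@eq_polydeg 0 (fun=> 1)) => // x; rewrite big_nil.
rewrite big_cons; apply: eq_polydeg (polydegM (pF i) IHs) => x.
by rewrite big_cons.
Qed.

(* In [jmu] the literals are parsed in [ring_scope], over the semiring [nat]. *)
Lemma jmuE (j : 'I_n.*2.+1) : jmu j = (if j < n.*2 then 1 else 2)%N.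
Proof. by []. Qed.

(** The noncentral exponents are homomorphisms to the integers. The difference of the central one by
    [g] is a constant minus [dot x.1.2 g.1.1], which is additive in [x]; so its degree is at most
    2. *)
Lemma polydeg_hcoord (j : 'I_n.*2.+1) :
  polydeg (jmu j) (fun x => (hcoord j x)%:~R).
Proof.
rewrite jmuE; case: ifP => lt_j g.
  move=> h x; rewrite /= !hcoordM lt_j !subr0 -!rmorphB /=; congr (_ %:~R).
  by ring.
move=> h k x; rewrite /= !hcoordM lt_j -!rmorphB /=; congr (_ %:~R).
case: x g h k => [[ax bx] cx] [[a b] c] [[a' b'] c'] [[a2 b2] c2] /=.
by rewrite !dotDl; ring.
Qed.

Definition ga_eval f s : R := \sum_(p <- s) p.1 * f p.2.

(** A list may repeat group elements, so evaluation has to be shown to depend only on the collected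
    coefficients; [U] is a finite set containing both supports. *)
Lemma ga_eval_coef f s t : ga_coef s =1 ga_coef t -> ga_eval f s = ga_eval f t.
Proof.
move=> eq_st; pose U := undup [seq p.2 | p <- s ++ t].
have evalE s' : {subset [seq p.2 | p <- s'] <= U} ->
    ga_eval f s' = \sum_(x <- U) ga_coef s' x * f x.
  move=> sub; rewrite /ga_coef.
  under eq_bigr do rewrite mulr_suml.
  rewrite exchange_big /=; apply: eq_big_seq => p ps.
  rewrite (bigD1_seq p.2) ?undup_uniq //=; last exact/sub/map_f.
  rewrite eqxx big1 ?addr0 // => x /negbTE; rewrite eq_sym => ->.
  by rewrite mul0r.
rewrite !evalE; first by apply: eq_bigr => x _; rewrite eq_st.
- by move=> x xs; rewrite mem_undup map_cat mem_cat xs orbT.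
- by move=> x xs; rewrite mem_undup map_cat mem_cat xs.
Qed.

Lemma eq_ga_eval f1 f2 s : f1 =1 f2 -> ga_eval f1 s = ga_eval f2 s.
Proof. by move=> eqf; apply: eq_bigr => p _; rewrite eqf. Qed.

Lemma ga_evalD f1 f2 s :
  ga_eval (fun x => f1 x + f2 x) s = ga_eval f1 s + ga_eval f2 s.
Proof. by rewrite -big_split; apply: eq_bigr => p _; rewrite mulrDr. Qed.

Lemma ga_evalZ c f s : ga_eval (fun x => c * f x) s = c * ga_eval f s.
Proof. by rewrite mulr_sumr; apply: eq_bigr => p _; rewrite mulrCA. Qed.

Lemma ga_eval_cat f s t : ga_eval f (s ++ t) = ga_eval f s + ga_eval f t.
Proof. by rewrite /ga_eval big_cat. Qed.

Lemma ga_eval_flatten f (I : Type) (L : seq I) (F : I -> ga R n) :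
  ga_eval f (flatten [seq F i | i <- L]) = \sum_(i <- L) ga_eval f (F i).
Proof.
elim: L => [|i L IHL] /=; first by rewrite big_nil /ga_eval big_nil.
by rewrite ga_eval_cat big_cons IHL.
Qed.

Lemma ga_eval_scale f c s : ga_eval f (ga_scale c s) = c * ga_eval f s.
Proof.
by rewrite /ga_eval big_map mulr_sumr; apply: eq_bigr => p _; rewrite mulrA.
Qed.

Lemma ga_eval_of f g : ga_eval f (ga_of R g) = f g.
Proof. by rewrite /ga_eval big_seq1 mul1r. Qed.

Lemma ga_eval_mul f s t :
  ga_eval f (ga_mul s t) = \sum_(p <- s) p.1 * ga_eval (fun x => f (heis_mul p.2 x)) t.
Proof.
rewrite /ga_eval /ga_mul big_allpairs_dep /=; apply: eq_bigr => p _.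
by rewrite mulr_sumr; apply: eq_bigr => q _; rewrite mulrA.
Qed.

Lemma ga_eval_mul_of f s g :
  ga_eval f (ga_mul s (ga_of R g)) = ga_eval (fun x => f (heis_mul x g)) s.
Proof. by rewrite ga_eval_mul; apply: eq_bigr => p _; rewrite ga_eval_of. Qed.

Lemma ga_eval_mulA f s t t' :
  ga_eval f (ga_mul (ga_mul s t) t') = ga_eval f (ga_mul s (ga_mul t t')).
Proof.
rewrite !ga_eval_mul /ga_mul big_allpairs_dep /=; apply: eq_bigr => p _.
rewrite -/(ga_mul t t') ga_eval_mul mulr_sumr; apply: eq_bigr => q _.
rewrite -mulrA; congr (_ * (_ * _)); apply: eq_ga_eval => x.
by rewrite heis_mulA.
Qed.

(** The transpose of left multiplication by [1 - g]. *)
Definition ldiff g f : heis n -> R := fun x => f x - f (heis_mul g x).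

Lemma ga_eval_mul_u f g s :
  ga_eval f (ga_mul (ga_u R g) s) = ga_eval (ldiff g f) s.
Proof.
rewrite ga_eval_mul /ga_u big_cons big_seq1 mul1r -ga_evalZ -ga_evalD.
by apply: eq_ga_eval => x; rewrite heis_mul1g mulN1r.
Qed.

Lemma ga_eval_mul_pow f g r s :
  ga_eval f (ga_mul (ga_pow (ga_u R g) r) s) = ga_eval (iter r (ldiff g) f) s.
Proof.
elim: r f => [|r IHr] f.
  rewrite ga_eval_mul big_seq1 mul1r; apply: eq_ga_eval => x.
  by rewrite heis_mul1g.
by rewrite /ga_pow iterS ga_eval_mulA ga_eval_mul_u IHr -iterSr.
Qed.

Lemma ga_eval_in_I3 f s : polydeg 2 f -> in_I3 s -> ga_eval f s = 0.
Proof.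
move=> pf [L /(ga_eval_coef f) ->]; rewrite ga_eval_flatten big1 // => l _.
case: l => [[[c g] h] k].
rewrite ga_eval_scale !ga_eval_mul_u /ga_u /ga_eval big_cons big_seq1 /ldiff.
(* The third right difference of [f] by [k], [h], [g] at the identity is minus the value of [f] on
   [(1 - g)(1 - h)(1 - k)]. *)
have /= : _ - _ - (_ - _) = _ - _ - (_ - _) := pf k h g (heis_one n).
rewrite !heis_mul1g !heis_mulg1 !heis_mulA => /eqP; rewrite -subr_eq0 => /eqP e.
by rewrite /= -[RHS](mulr0 (- c)) -e; ring.
Qed.

End PolynomialFunctions.

(** * Functions dual to the Jennings basis *)

Section DualBasis.
Variables (R : fieldType) (n : nat).
Hypothesis pchar0 : [pchar R] =i pred0.
Implicit Types (q r : jidx n) (g x : heis n).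

(** Allows identities between integer matrix entries to be checked in [R]. *)
Lemma intr_inj_pchar0 : injective (fun z : int => z%:~R : R).
Proof.
have nat0 m : (m%:R : R) = 0 -> m = 0%N.
  by move=> m0; apply/eqP; rewrite -((pcharf0P R).1 pchar0) m0.
move=> y z /eqP; rewrite -subr_eq0 -intrB => /eqP yz0; apply/eqP; rewrite -subr_eq0.
case: (y - z) yz0 => m; first by move/nat0 ->.
by rewrite NegzE intrN => /eqP; rewrite oppr_eq0 => /eqP /nat0.
Qed.

(* (-1)^q binom(t, q) for q <= 2 *)
Definition sbinom (q : nat) (t : R) : R :=
  if q is q'.+1 then (if q' is 0 then - t else t * (t - 1) / 2) else 1.

Lemma polydeg_sbinom k (q : 'I_3) (f : heis n -> R) :
  polydeg k f -> polydeg (q * k) (fun x => sbinom q (f x)).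
Proof.
move=> pf; case: q => -[|[|[|//]]] _ /=.
- by [].
- by rewrite mul1n; apply: eq_polydeg (polydegZ (-1) pf) => x; ring.
rewrite mulSn mul1n.
apply: (@eq_polydeg _ _ _ (fun x => 2^-1 * (f x * (f x + -1)))).
  by move=> x; ring.
by apply/polydegZ/polydegM/polydegD/polydeg_cst.
Qed.

Definition jdual q x : R := \prod_(i < n.*2.+1) sbinom (val q i) (hcoord i x)%:~R.

Lemma polydeg_jdual q : polydeg 2 (jdual q).
Proof.
apply: polydegW (valP q) _; apply: polydeg_prod => i.
exact/polydeg_sbinom/polydeg_hcoord.
Qed.

(** The [r]-th difference only involves the values at [g^k x] with [k <= 2], and the sign in
    [sbinom] matches that of [ldiff], so the [r]-th difference of [sbinom q] at 0 is a Kronecker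
    symbol. *)
Lemma iter_ldiff_sbinom (q r : 'I_3) (g x : heis n) (f : heis n -> R) (K : R) :
  (forall k, (k < 3)%N -> f (iter k (heis_mul g) x) = K * sbinom q k%:R) ->
  iter r (ldiff g) f x = K * (q == r)%:R.
Proof.
have nz2 : (2 : R) != 0 by rewrite ((pcharf0P R).1 pchar0).
move=> fE; have := fE 0%N isT; have := fE 1%N isT; have := fE 2%N isT.
by case: q r {fE} => -[|[|[|//]]] ? [[|[|[|//]]] ?]; rewrite -val_eqE /ldiff /=
  => e2 e1 e0; rewrite ?e2 ?e1 ?e0; field.
Qed.

(** Peeling the leftmost power of [u_i] turns it into a difference in the exponent [i] alone and
    multiplies [K] by a Kronecker symbol. The product formula for [f] is assumed only where the
    exponents outside [s] vanish, which is what survives the induction. *)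
Lemma jdual_jbasis_suffix q r (s : seq 'I_(n.*2.+1)) (f : heis n -> R) (K : R) :
  sorted ltn (map val s) ->
  (forall x, (forall j, j \notin s -> hcoord j x = 0) ->
     f x = K * \prod_(j <- s) sbinom (val q j) (hcoord j x)%:~R) ->
  ga_eval f (foldr (@ga_mul R n) (ga_one R n)
    [seq ga_pow (ga_u R (heis_gen n i)) (val r i) | i : 'I_(n.*2.+1) <- s])
  = K * \prod_(j <- s) (val q j == val r j)%:R.
Proof.
elim: s f K => [|i s IHs] f K /= s_sorted fE.
  by rewrite ga_eval_of fE ?big_nil // => j _; rewrite hcoord_one.
rewrite ga_eval_mul_pow big_cons mulrA; apply: IHs; first exact: path_sorted s_sorted.
have lt_is j : j \in s -> (i < j)%N.
  have /allP lt_is := order_path_min ltn_trans s_sorted.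
  by move=> js; apply/lt_is/map_f.
move=> x x0; rewrite mulrAC; apply: iter_ldiff_sbinom => k lt_k3.
(* Since [s] is increasing, all exponents of [x] before [i] vanish and [hcoord_genM] applies at each
   multiplication. *)
have xk0 (j : 'I_(n.*2.+1)) m :
    hcoord j (iter m (heis_mul (heis_gen n i)) x) = hcoord j x + (m * (j == i))%:R.
  elim: m j => [|m IHm] j; first by rewrite addr0.
  rewrite iterS hcoord_genM // ?IHm; first by rewrite mulSn addrC natrD addrCA addrC.
  move=> j' lt_j'i; have lt_j' := ltn_trans lt_j'i (ltn_ord i).
  rewrite (IHm (Ordinal lt_j')) x0 ?add0r; last by apply/negP => /lt_is /=; lia.
  by rewrite -val_eqE /= (ltn_eqF lt_j'i) muln0.
rewrite fE => [|j]; last first.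
  rewrite inE xk0 => /norP[/negbTE -> /x0 ->]; by rewrite muln0.
rewrite big_cons xk0 x0; last by apply/negP => /lt_is; rewrite ltnn.
rewrite eqxx muln1 add0r mulrA mulrAC; congr (_ * _ * sbinom _ _); last by rewrite rmorph_nat.
apply: eq_big_seq => j /lt_is lt_ij; rewrite xk0 -val_eqE /= (gtn_eqF lt_ij).
by rewrite muln0 addr0.
Qed.

Lemma jdual_jbasis q r : ga_eval (jdual q) (jbasis R r) = (q == r)%:R.
Proof.
rewrite (@jdual_jbasis_suffix q r _ (jdual q) 1).
- rewrite mul1r big_enum /=; have [->|ne_qr] := eqVneq q r.
    by rewrite big1 // => i _; rewrite eqxx.
  have /existsP[i ne_i] : [exists i, val q i != val r i].
    apply: contraR ne_qr; rewrite negb_exists => /forallP eq_qr.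
    by apply/eqP/val_inj/ffunP => i; have /negPn/eqP := eq_qr i.
  by rewrite (bigD1 i) //= (negbTE ne_i) mul0r.
- by rewrite val_enum_ord iota_ltn_sorted.
by move=> x _; rewrite mul1r big_enum.
Qed.

End DualBasis.

(** * Basis indices of weight at most 2 and the centre *)

Section BasisIndices.
Variable n : nat.
Implicit Types (q : jidx n) (k : 'I_n.*2.+1) (x : heis n).

Lemma jweight0 : (@jweight n [ffun=> ord0] <= 2)%N.
Proof. by rewrite /jweight big1 // => i _; rewrite ffunE. Qed.

Definition jidx0 : jidx n := Sub [ffun=> ord0] jweight0.

Lemma jweight1 k : (jweight [ffun i => inord (i == k) : 'I_3] <= 2)%N.
Proof.
rewrite /jweight (bigD1 k) //= big1 => [|i /negbTE ne_ik].
  by rewrite ffunE eqxx inordK // mul1n addn0 jmuE; case: ifP.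
by rewrite ffunE ne_ik inordK.
Qed.

Definition jidx1 k : jidx n := Sub [ffun i => inord (i == k)] (jweight1 k).

Lemma jidx1_inj : injective jidx1.
Proof.
move=> k l /(congr1 (fun q : jidx n => val q k : nat)).
by rewrite /= !ffunE eqxx !inordK //; case: eqP.
Qed.

Lemma jidx1_neq0 k : jidx1 k != jidx0.
Proof.
apply/eqP => /(congr1 (fun q : jidx n => val q k : nat)).
by rewrite /= !ffunE eqxx inordK.
Qed.

(** The factor [u_{2n+1}] has weight 2 and leaves no room for another one. *)
Lemma jidx_center q : val q ord_max != ord0 -> q = jidx1 ord_max.
Proof.
move=> q_max; have := valP q; rewrite /jweight (bigD1 ord_max) //= jmuE /= ltnn.
have q_gt0 : (0 < val q ord_max)%N by rewrite lt0n.
have arith (a b : nat) : (a * 2 + b <= 2 -> 0 < a -> a = 1 /\ b = 0)%N by lia.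
case/arith => // q1 /eqP S0; apply/val_inj/ffunP => i; apply/val_inj; rewrite /= ffunE.
have [->|ne_i] := eqVneq i ord_max; rewrite inordK //.
move: S0; rewrite sum_nat_eq0 => /forallP /(_ i); rewrite ne_i /= muln_eq0 jmuE.
by case: ifP => _; rewrite orbF => /eqP.
Qed.

Lemma ga_eval_jbasis0 (R : comNzRingType) (f : heis n -> R) :
  ga_eval f (jbasis R jidx0) = f (heis_one n).
Proof.
rewrite /jbasis; elim: (enum _) => [|i s IHs] /=; first by rewrite ga_eval_of.
by rewrite ga_eval_mul_pow ffunE.
Qed.

Lemma jdual0 (R : fieldType) x : jdual R jidx0 x = 1.
Proof. by rewrite /jdual big1 // => i _; rewrite ffunE. Qed.

Lemma jdual1 (R : fieldType) k x : jdual R (jidx1 k) x = - (hcoord k x)%:~R.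
Proof.
rewrite /jdual (bigD1 k) //= big1 => [|i /negbTE ne_ik].
  by rewrite ffunE eqxx inordK // mulr1.
by rewrite ffunE ne_ik inordK.
Qed.

Definition hcenter (m : int) : heis n := ((0, 0), m).

Lemma hcoord_mul_center (j : nat) (x : heis n) m :
  hcoord j (heis_mul x (hcenter m)) = hcoord j x + (if (j < n.*2)%N then 0 else m).
Proof.
rewrite hcoordM /= !dot0l dot0r if_same !subr0; case: (ltnP j n) => // lt_jn.
by rewrite ifT // -addnn ltn_addr.
Qed.

(** By [jidx_center], only the function dual to [u_{2n+1}] sees the central exponent. The factor
    [jdual R jidx0 x], equal to 1, is written out so that evaluation on a basis vector gives
    Kronecker symbols throughout. *)
Lemma jdual_mul_center (R : fieldType) q x m :
  jdual R q (heis_mul x (hcenter m)) =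
    jdual R q x - m%:~R * (q == jidx1 ord_max)%:R * jdual R jidx0 x.
Proof.
rewrite jdual0 mulr1; have [q0|/jidx_center ->] := eqVneq (val q ord_max) ord0.
  have [q1|_] := eqVneq q (jidx1 ord_max).
    by have := congr1 (@nat_of_ord 3) q0; rewrite q1 /= ffunE eqxx inordK.
  rewrite mulr0 subr0; apply: eq_bigr => i _; rewrite hcoord_mul_center.
  case: ifP => [_|le_2n]; first by rewrite addr0.
  suff -> : i = ord_max by rewrite q0.
  by apply/val_inj => /=; move: (ltn_ord i) le_2n; lia.
by rewrite eqxx mulr1 !jdual1 hcoord_mul_center ltnn intrD opprD.
Qed.

Lemma heis_gen_center : heis_gen n n.*2 = hcenter 1.
Proof. by rewrite /heis_gen -addnn ltnNge leq_addr ltnn. Qed.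

Lemma hcenterM l m : heis_mul (hcenter l) (hcenter m) = hcenter (l + m).
Proof. by rewrite heis_mulE dot0l !addr0. Qed.

End BasisIndices.

(** * Entries of the Jennings matrices *)

Section JenningsMatrices.
Variables (R : fieldType) (n d : nat) (sigma : 'I_d -> jidx n) (rho : heis n -> 'M[int]_d).
Hypotheses (pchar0 : [pchar R] =i pred0) (sigma_bij : bijective sigma).
Hypothesis rhoP : forall g, jennings_matrix R sigma g (rho g).

(** The defining congruence modulo [I^3] becomes an equality under any function of degree at most
    2. *)
Lemma jennings_eval f g i : polydeg 2 f ->
  ga_eval (fun x => f (heis_mul x g)) (jbasis R (sigma i))
    = \sum_j (rho g i j)%:~R * ga_eval f (jbasis R (sigma j)).
Proof.
move=> pf; have := ga_eval_in_I3 pf (rhoP g i).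
rewrite ga_eval_cat ga_eval_mul_of ga_eval_scale ga_eval_flatten mulN1r => /subr0_eq ->.
by rewrite big_enum; apply: eq_bigr => j _; rewrite ga_eval_scale.
Qed.

Lemma jennings_entry g i j :
  (rho g i j)%:~R = ga_eval (fun x => jdual R (sigma j) (heis_mul x g)) (jbasis R (sigma i)).
Proof.
rewrite jennings_eval; last exact: polydeg_jdual.
rewrite (bigD1 j) //= jdual_jbasis // eqxx mulr1 big1 ?addr0 // => k /negbTE ne_kj.
by rewrite jdual_jbasis // (inj_eq (bij_inj sigma_bij)) eq_sym ne_kj mulr0.
Qed.

Lemma jennings_mul g h : rho (heis_mul g h) = rho g *m rho h.
Proof.
apply/matrixP => i j; apply: (intr_inj_pchar0 pchar0).
rewrite mxE rmorph_sum jennings_entry.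
rewrite (eq_ga_eval _ (fun x => congr1 _ (heis_mulA x g h))).
(* The translate by [h] of a dual function still has degree at most 2, so it can be expanded along
   row [i] of [rho g]. *)
rewrite (jennings_eval g i (polydeg_shift h (polydeg_jdual R (sigma j)))).
by apply: eq_bigr => k _; rewrite rmorphM /= [(rho h k j)%:~R]jennings_entry.
Qed.

Lemma jennings_center m i0 j0 : sigma i0 = jidx0 n -> sigma j0 = jidx1 ord_max ->
  rho (hcenter n m) = 1%:M + (- m) *: delta_mx i0 j0.
Proof.
move=> s_i0 s_j0; apply/matrixP => i j; apply: (intr_inj_pchar0 pchar0).
rewrite jennings_entry.
rewrite (eq_ga_eval _ (fun x => jdual_mul_center R (sigma j) x m)).
under eq_ga_eval => x do rewrite -mulNr.
rewrite ga_evalD ga_evalZ !jdual_jbasis // -s_i0 -s_j0 !(inj_eq (bij_inj sigma_bij)).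
rewrite !mxE intrD intrM intrN !rmorph_nat.
by rewrite [j == i]eq_sym [i0 == i]eq_sym -mulnb natrM; ring.
Qed.

Lemma jennings_one : rho (heis_one n) = 1%:M.
Proof.
have [tau _ sigmaK] := sigma_bij.
by rewrite (@jennings_center 0 _ _ (sigmaK _) (sigmaK _)) oppr0 scale0r addr0.
Qed.

Lemma jennings_foldr (s : seq (heis n)) :
  foldr mulmx 1%:M (map rho s) = rho (foldr (@heis_mul n) (heis_one n) s).
Proof. by elim: s => [|g s IHs] /=; rewrite ?jennings_one // jennings_mul IHs. Qed.

(** The row of the basis vector 1 is the expansion of [g] itself. It serves both to order the basis
    and to read off the central exponent. *)
Lemma jennings_row0 g i0 k j : sigma i0 = jidx0 n -> sigma j = jidx1 k ->
  rho g i0 j = - hcoord k g.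
Proof.
move=> s_i0 s_j; apply: (intr_inj_pchar0 pchar0).
by rewrite jennings_entry s_i0 s_j ga_eval_jbasis0 heis_mul1g jdual1 intrN.
Qed.

(** Right multiplication by the generator of index [k] lowers the central exponent by the exponent
    of index [n + k]. The resulting nonzero entry places [u_{n+k+1}] before [u_{2n+1}]. *)
Lemma jennings_gen_center (k : nat) (l : 'I_n.*2.+1) p j0 :
  (k < n)%N -> l = (n + k)%N :> nat ->
  sigma p = jidx1 l -> sigma j0 = jidx1 ord_max -> rho (heis_gen n k) p j0 = - 1.
Proof.
move=> lt_kn lE s_p s_j0; apply: (intr_inj_pchar0 pchar0).
rewrite jennings_entry s_p s_j0.
rewrite (@eq_ga_eval _ _ _ (fun x => jdual R (jidx1 ord_max) x + -1 * jdual R (jidx1 l) x)).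
  rewrite ga_evalD ga_evalZ !jdual_jbasis // eqxx mulr1 (inj_eq (@jidx1_inj n)).
  rewrite -val_eqE /= lE -addnn eqn_add2l gtn_eqF //= add0r.
  by rewrite intrN.
move=> x; rewrite !jdual1 hcoordM lE /= ltnn.
rewrite (hcoord_gen (ltnSn _)) ?gtn_eqF; try lia.
by rewrite addr0 /heis_gen lt_kn hcoord_addn // intrB; ring.
Qed.

End JenningsMatrices.

(** * Growth of exponents along words in the Heisenberg group *)

Section HeisenbergWords.
Variable n : nat.
Implicit Types (g h : heis n) (w : seq (heis n)).

Definition heis_gens : seq (heis n) :=
  flatten [seq [:: heis_gen n k; heis_inv (heis_gen n k)] | k <- iota 0 n.*2.+1].

Lemma heis_gensP g : g \in heis_gens ->
  exists2 k, (k < n.*2.+1)%N & g = heis_gen n k \/ g = heis_inv (heis_gen n k).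
Proof.
case/flatten_mapP => k; rewrite mem_iota => lt_k; rewrite !inE => g_k.
by exists k => //; case/orP: g_k => /eqP; [left|right].
Qed.

(** In the central exponent of the inverse the two terms [dot a b] cancel, leaving [- c]. *)
Lemma hcoord_inv j g :
  hcoord j (heis_inv g) = if (j < n.*2)%N then - hcoord j g else - g.2.
Proof.
case: g => [[a b] c] /=; rewrite -/(dot a b) !dotNl [dot b _]dotC [dot a (- b)]dotC dotNl.
case: ifP => [?|_]; first by rewrite ifT //; lia.
by case: ifP => _; [rewrite dotC | rewrite (dotC b); ring].
Qed.

Lemma heis_gens_hcoord j g : (j < n.*2.+1)%N -> g \in heis_gens -> `|hcoord j g| <= 1.
Proof.
move=> lt_j /heis_gensP[k lt_k [->|->]]; first by rewrite hcoord_gen //; case: eqP.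
rewrite hcoord_inv; case: ifP => _; rewrite normrN.
  by rewrite hcoord_gen //; case: eqP.
by rewrite /heis_gen; case: ifP => // _; case: ifP.
Qed.

Lemma heis_gens_dot g h (m : int) : g \in heis_gens -> 0 <= m ->
  (forall j, (j < n)%N -> `|hcoord j h| <= m) -> `|dot g.1.2 h.1.1| <= m.
Proof.
move=> /heis_gensP[k lt_k gE] m_ge0 h_le.
suff le_m : `|dot (heis_gen n k).1.2 h.1.1| <= m.
  case: gE => -> //; case: (heis_gen n k) le_m => [[a b] c] /=.
  by rewrite dotNl normrN.
rewrite /heis_gen; case: (ltnP k n) => [?|le_nk] /=; first by rewrite dot0l.
case: (ltnP k n.*2) => [?|?] /=; last by rewrite dot0l.
have lt_kn : (k - n < n)%N by lia.
by have := h_le _ lt_kn; case: h {h_le} => [[a b] c] /=; rewrite lt_kn dotC.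
Qed.

(** Prefixing a generator to a word of length [L] changes each noncentral exponent by at most 1, and
    the central one by at most [1 + L], the [L] bounding the collection term. *)
Lemma hcoord_word w : all (mem heis_gens) w ->
  let g := foldr (@heis_mul n) (heis_one n) w in
  (forall j, (j < n.*2)%N -> `|hcoord j g| <= (size w)%:R) /\
  `|hcoord n.*2 g| <= (size w * (size w).+1)%:R.
Proof.
elim: w => [_|g w IHw /= /andP[g_gen /IHw[le1 le2]]].
  by split=> [j _|]; rewrite hcoord_one.
set h := foldr _ _ _ in le1 le2 *; split=> [j lt_j|].
  rewrite hcoordM lt_j subr0 -natr1 addrC (le_trans (ler_normD _ _)) // lerD ?le1 //.
  by apply: heis_gens_hcoord => //; lia.
rewrite hcoordM ltnn.
have dot_le : `|dot g.1.2 h.1.1| <= (size w)%:R.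
  by apply: heis_gens_dot => // j lt_j; apply: le1; lia.
have g_le := heis_gens_hcoord (ltnSn _) g_gen.
rewrite (le_trans (ler_normB _ _)) // (le_trans (lerD (ler_normD _ _) dot_le)) //.
apply: le_trans (_ : 1 + (size w * (size w).+1)%:R + (size w)%:R <= _).
  by rewrite !lerD.
by rewrite -[1]/(1%:R) -!natrD ler_nat; nia.
Qed.

End HeisenbergWords.

(** * Short words for elementary unitriangular matrices *)

Section UnitriangularWords.
Variable d : nat.
Implicit Types (S : seq 'M[int]_d) (A B M N : 'M[int]_d) (i p q j : 'I_d) (s t : int).

Lemma word_ball_mul S k l M N :
  word_ball S k M -> word_ball S l N -> word_ball S (k + l) (M *m N).
Proof.
case=> [v [Sv size_v vE]] [w [Sw size_w wE]]; exists (v ++ w); split.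
- by rewrite all_cat Sv.
- by rewrite size_cat leq_add.
rewrite foldr_cat wE -vE; elim: v {Sv size_v vE} => [|A v IHv] /=.
  by rewrite mul1mx.
by rewrite IHv mulmxA.
Qed.

Lemma foldr_nseq_unipotent (m : nat) A : A *m A = 0 ->
  foldr mulmx 1%:M (nseq m (1%:M + A)) = 1%:M + A *+ m.
Proof.
move=> A2; elim: m => [|m IHm] /=; first by rewrite addr0.
rewrite IHm mulmxDl mul1mx mulmxDr mulmx1 -[A *+ m]scaler_nat -scalemxAr A2.
by rewrite scaler0 addr0 scaler_nat mulrS addrAC addrA.
Qed.

Definition elem_mx i j t : 'M[int]_d := 1%:M + t *: delta_mx i j.

Lemma word_ball_elem i j t : (i < j)%N -> word_ball (UT_gens d) `|t|%N (elem_mx i j t).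
Proof.
move=> lt_ij; pose e : int := if 0 <= t then 1 else -1.
have ij_gens : 1%:M + e *: delta_mx i j \in UT_gens d.
  apply/flatten_mapP; exists (i, j); first by rewrite mem_enum.
  by rewrite !inE /e; case: ifP; rewrite ?scale1r ?scaleN1r eqxx ?orbT.
exists (nseq `|t|%N (1%:M + e *: delta_mx i j)); split.
- by rewrite all_nseq; apply/orP; right.
- by rewrite size_nseq.
rewrite foldr_nseq_unipotent; last first.
  by rewrite -scalemxAl -scalemxAr mul_delta_mx_0 ?scaler0 // -val_eqE /= gtn_eqF.
rewrite /elem_mx -scaler_nat scalerA; congr (_ + _ *: _).
by rewrite /e natz abszE; case: ifP => ?; [rewrite mulr1|]; lia.
Qed.

(** As the squares vanish, [1 - A] and [1 - B] are the inverses, so the left side is a group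
    commutator. *)
Lemma unipotent_commutator A B : A *m A = 0 -> B *m B = 0 -> B *m A = 0 ->
  (1%:M + A) *m (1%:M + B) *m ((1%:M - A) *m (1%:M - B)) = 1%:M + A *m B.
Proof.
move=> A2 B2 BA.
rewrite !(mulmxDl, mulmxDr, mulmxN, mulNmx, mul1mx, mulmx1, mulmxA) !opprK.
rewrite A2 B2 BA -!(mulmxA A) ?(mulmxA B) ?A2 ?B2 ?BA ?(mul0mx, mulmx0).
move: (A *m B) => X; apply/matrixP => i j; rewrite !mxE; ring.
Qed.

(** The commutator contains each factor together with its inverse; hence both signs are assumed and
    the lengths are doubled. *)
Lemma word_ball_commutator i p j s t k l : (i < p)%N -> (p < j)%N ->
  (forall e : bool, word_ball (UT_gens d) k (elem_mx i p ((-1) ^+ e * s))) ->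
  (forall e : bool, word_ball (UT_gens d) l (elem_mx p j ((-1) ^+ e * t))) ->
  word_ball (UT_gens d) (k + l + (k + l)) (elem_mx i j (s * t)).
Proof.
move=> lt_ip lt_pj ball_k ball_l.
have -> : elem_mx i j (s * t) =
    elem_mx i p s *m elem_mx p j t *m (elem_mx i p (- s) *m elem_mx p j (- t)).
  rewrite /elem_mx !scaleNr unipotent_commutator; last 3 first.
  - by rewrite -scalemxAl -scalemxAr mul_delta_mx_0 ?scaler0 // -val_eqE /= gtn_eqF.
  - by rewrite -scalemxAl -scalemxAr mul_delta_mx_0 ?scaler0 // -val_eqE /= gtn_eqF.
  - rewrite -scalemxAl -scalemxAr mul_delta_mx_0 ?scaler0 // -val_eqE /= gtn_eqF //.
    exact: ltn_trans lt_pj.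
  by rewrite -scalemxAl -scalemxAr mul_delta_mx scalerA.
apply/word_ball_mul; apply/word_ball_mul.
- by have := ball_k false; rewrite mul1r.
- by have := ball_l false; rewrite mul1r.
- by have := ball_k true; rewrite mulN1r.
- by have := ball_l true; rewrite mulN1r.
Qed.

(* An entry at distance at least 3 from the diagonal is an iterated commutator of weight 3,
   so its k^3-th power has length O(k). *)
Lemma word_ball_cube i p q j (k : nat) : (i < p)%N -> (p < q)%N -> (q < j)%N ->
  word_ball (UT_gens d) (10 * k) (elem_mx i j (- (k ^ 3)%:R)).
Proof.
move=> lt_ip lt_pq lt_qj.
(* The inner commutator costs [4k], the outer one twice [k + 4k]. *)
have -> : (10 * k = k + (k + k + (k + k)) + (k + (k + k + (k + k))))%N by lia.
have -> : - (k ^ 3)%:R = k%:R * (k%:R * - k%:R) :> int by rewrite natrX; ring.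
have ball1 i' j' t : (i' < j')%N -> `|t|%N = k ->
    forall e : bool, word_ball (UT_gens d) k (elem_mx i' j' ((-1) ^+ e * t)).
  by move=> lt_ij tk e; rewrite -tk -(abszMsign e) mulrC; apply: word_ball_elem.
apply: (@word_ball_commutator i p) => //; first exact: ltn_trans lt_qj.
  by apply: ball1; rewrite // natz.
move=> e; rewrite mulrA; apply: (@word_ball_commutator p q) => // e'.
  by apply: ball1; rewrite // natz; case: e; rewrite ?mulN1r ?mul1r ?abszN.
by apply: ball1; rewrite // abszN natz.
Qed.

End UnitriangularWords.

(** * Distortion of the image *)

Lemma heis_image_gensE (n d : nat) (rho : heis n -> 'M[int]_d) :
  heis_image_gens rho = map rho (heis_gens n).
Proof. by rewrite /heis_gens map_flatten -map_comp. Qed.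

(** Lifts a word in the images of the generators to a word in [G]. *)
Lemma all_mem_map (T U : eqType) (f : T -> U) (s : seq T) (w : seq U) :
  all (mem (map f s)) w -> exists2 v, all (mem s) v & w = map f v.
Proof.
elim: w => [_|y w IHw /= /andP[/mapP[x xs ->] /IHw[v sv ->]]]; first by exists [::].
by exists (x :: v) => //=; rewrite [_ \in _]xs.
Qed.

Theorem theorem4p2 (R : fieldType) (n d : nat) (sigma : 'I_d -> jidx n)
    (rho : heis n -> 'M[int]_d) :
  [pchar R] =i pred0 ->
  (2 <= n)%N ->
  bijective sigma ->
  (forall g : heis n, jennings_matrix R sigma g (rho g)) ->
  (forall g : heis n, upper_unitri (rho g)) ->
  distorted (UT_gens d) (heis_image_gens rho).
Proof.
move=> pchar0 n_ge2 sigma_bij rhoP rho_tri [C Cmax].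
have [tau _ sigmaK] := sigma_bij.
have tri_lt g i j : rho g i j != 0 -> i != j -> (i < j)%N.
  move=> nz ne_ij; rewrite ltnNge; apply: contra nz => le_ji.
  by apply/eqP; apply: (rho_tri g i j).1; rewrite ltn_neqAle eq_sym ne_ij.
pose i0 := tau (jidx0 n); pose j0 := tau (jidx1 (@ord_max n.*2)).
have s_i0 : sigma i0 = jidx0 n := sigmaK _.
have s_j0 : sigma j0 = jidx1 ord_max := sigmaK _.
(* u_{n+1}, u_{n+2} come after 1 and before u_{2n+1}. *)
have between (k : nat) : (k < n)%N -> exists2 p : 'I_d, (i0 < p < j0)%N &
    forall l : 'I_n.*2.+1, l = (n + k)%N :> nat -> sigma p = jidx1 l.
  move=> lt_kn; have lt_l : (n + k < n.*2.+1)%N by lia.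
  pose l := Ordinal lt_l; exists (tau (jidx1 l)) => [|l' l'E]; last first.
    by rewrite sigmaK; congr jidx1; apply/val_inj.
  have s_p := sigmaK (jidx1 l); apply/andP; split.
    apply: (tri_lt (heis_gen n (n + k))).
      by rewrite (jennings_row0 pchar0 sigma_bij rhoP _ s_i0 s_p) hcoord_gen // eqxx.
    by rewrite (can_eq sigmaK) eq_sym jidx1_neq0.
  apply: (tri_lt (heis_gen n k)).
    by rewrite (jennings_gen_center pchar0 sigma_bij rhoP lt_kn _ s_p s_j0).
  by rewrite (can_eq sigmaK) (inj_eq (@jidx1_inj n)) -val_eqE /= -addnn eqn_add2l ltn_eqF.
have [p [q [lt_ip lt_pq lt_qj]]] :
    exists p q : 'I_d, [/\ (i0 < p)%N, (p < q)%N & (q < j0)%N].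
  have [p /andP[lt_ip lt_pj] s_p] := between 0%N (ltnW n_ge2).
  have [q /andP[lt_iq lt_qj] s_q] := between 1%N n_ge2.
  (* The relative order of [u_{n+1}] and [u_{n+2}] is unknown, but either order gives a chain;
     [n >= 2] supplies the second vector. *)
  case: (ltngtP p q) => [?|?|/val_inj eq_pq]; [by exists p, q | by exists q, p |].
  have lt0 : (n + 0 < n.*2.+1)%N by lia.
  have lt1 : (n + 1 < n.*2.+1)%N by lia.
  have := s_q (Ordinal lt1) erefl; rewrite -eq_pq (s_p (Ordinal lt0) erefl).
  by move/jidx1_inj/(congr1 val) => /=; lia.
(* A word of length at most [D k] has central exponent at most [D k (D k + 1) <= D (D + 1) k^2],
   which is below [k^3] as soon as [k > D (D + 1)]. *)
pose D := (C * 10)%N; pose k := (D * D.+1).+1; pose g := hcenter n (k ^ 3)%:R.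
have gE : rho g = elem_mx i0 j0 (- (k ^ 3)%:R).
  exact: (jennings_center pchar0 sigma_bij rhoP _ s_i0 s_j0).
(* Membership in the image: any length will do, here that of the obvious power of [x_{2n+1}]. *)
have g_gen : exists m, word_ball (heis_image_gens rho) m (rho g).
  exists (k ^ 3)%N, (nseq (k ^ 3) (rho (hcenter n 1))); split; rewrite ?size_nseq //.
    rewrite all_nseq heis_image_gensE; apply/orP; right; apply/map_f.
    apply/flatten_mapP; exists n.*2; first by rewrite mem_iota add0n ltnSn.
    by rewrite heis_gen_center inE eqxx.
  rewrite -map_nseq (jennings_foldr pchar0 sigma_bij rhoP) /g; congr rho.
  elim: (k ^ 3)%N => //= m ->; by rewrite hcenterM -nat1r.
have := Cmax _ _ g_gen; rewrite {1}gE => /(_ _ (word_ball_cube k lt_ip lt_pq lt_qj)).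
case=> w []; rewrite heis_image_gensE => /all_mem_map[v /hcoord_word[_ v_le] ->].
rewrite size_map (jennings_foldr pchar0 sigma_bij rhoP) => size_v.
(* This entry is minus the central exponent, so [v] and [g] have the same one. *)
move=> /matrixP /(_ i0 j0).
rewrite !(jennings_row0 pchar0 sigma_bij rhoP _ s_i0 s_j0) => /oppr_inj vg.
move: v_le; rewrite vg -[g]heis_mul1g hcoord_mul_center hcoord_one ltnn add0r.
rewrite normr_nat ler_nat leqNgt => /negP; apply.
apply: leq_ltn_trans (leq_mul size_v (size_v : (size v).+1 <= _.+1)%N) _.
rewrite mulnA -/D.
apply: (@leq_ltn_trans (D * D.+1 * k ^ 2)).
  by rewrite expnS expn1 mulnACA -!mulnA !leq_mul2l /k; nia.
by rewrite (expnS k 2) ltn_pmul2r.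
Qed.
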